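(* Let $H$ be a Hilbert space of arbitrary density character. Then $H$ has the SHAI property.
   Context: All Banach and Hilbert spaces are over $\mathbb{C}$; a Hilbert space is not assumed to be separable. For a Banach space $X$, $\mathcal{B}(X)$ denotes the algebra of bounded linear operators on $X$. A Banach space $X$ has the SHAI property (Surjective Homomorphisms Are Injective) if for every non-zero Banach space $Y$, every surjective algebra homomorphism $\psi: \mathcal{B}(X) \rightarrow \mathcal{B}(Y)$ (a linear multiplicative map; continuity is not assumed) is injective. *)

(* Defs.v *)
From HB Require Import structures.
From mathcomp Require Import all_boot all_order all_algebra.
From mathcomp Require Import sesquilinear complex.
From mathcomp Require Import all_classical reals topology tvs normedtype.

Set Implicit Arguments.
Unset Strict Implicit.
Unset Printing Implicit Defensive.

Import Order.TTheory GRing.Theory Num.Theory.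

Local Open Scope ring_scope.

Section BoundedOperators.
Context {K : numFieldType} {X : normedModType K}.

Definition bounded_linear : {pred X -> X} := [pred T : X -> X |
  `[< linear T /\ exists M : K, forall x : X, `|T x| <= M * `|x| >]].

Lemma bounded_linearP (T : X -> X) :
  reflect (linear T /\ exists M : K, forall x : X, `|T x| <= M * `|x|)
          (T \in bounded_linear).
Proof. exact: asboolP. Qed.

Lemma bounded_linear_ge0 (T : X -> X) : T \in bounded_linear ->
  exists2 M : K, 0 <= M & forall x : X, `|T x| <= M * `|x|.
Proof.
move=> /bounded_linearP[_ [M TM]]; exists `|M| => // x.
have Mx : 0 <= M * `|x| by apply: le_trans (TM x).
by rewrite (le_trans (TM x))// -[leLHS]ger0_norm// normrM normr_id.
Qed.

Lemma bounded_linear_submod : submod_closed bounded_linear.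
Proof.
split=> [|a S T Sb Tb].
  apply/bounded_linearP; split=> [a x y|]; first by rewrite /= scaler0 addr0.
  by exists 0 => x; rewrite normr0 mul0r.
have [M _ SM] := bounded_linear_ge0 Sb; have [N _ TN] := bounded_linear_ge0 Tb.
move: Sb Tb => /bounded_linearP[Sl _] /bounded_linearP[Tl _].
apply/bounded_linearP; split=> [b x y|].
  have fE z : (a *: S + T) z = a *: S z + T z by [].
  by rewrite !fE Sl Tl !scalerDr !scalerA mulrC addrACA.
exists (`|a| * M + N) => x; rewrite mulrDl -mulrA.
apply: le_trans (ler_normD _ _) _; apply: lerD => //.
by rewrite normrZ ler_wpM2l.
Qed.

HB.instance Definition _ :=
  GRing.isSubmodClosed.Build K (X -> X) bounded_linear bounded_linear_submod.

Lemma bounded_linear_id : idfun \in bounded_linear.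
Proof. by apply/bounded_linearP; split=> //; exists 1 => x; rewrite mul1r. Qed.

Lemma bounded_linear_comp (S T : X -> X) :
  S \in bounded_linear -> T \in bounded_linear -> S \o T \in bounded_linear.
Proof.
move=> Sb Tb.
have [M M0 SM] := bounded_linear_ge0 Sb; have [N _ TN] := bounded_linear_ge0 Tb.
move: Sb Tb => /bounded_linearP[Sl _] /bounded_linearP[Tl _].
apply/bounded_linearP; split=> [a x y|]; first by rewrite /= Tl Sl.
exists (M * N) => x; rewrite -mulrA (le_trans (SM _))//.
by rewrite ler_wpM2l.
Qed.

End BoundedOperators.

Record bounded_op (K : numFieldType) (X : normedModType K) := BoundedOp {
  bounded_op_fun :> X -> X;
  bounded_opP : bounded_op_fun \in bounded_linear }.

Notation "''B' ( X )" := (bounded_op X)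
  (at level 8, format "''B' ( X )") : type_scope.

Section BoundedOperatorAlgebra.
Context {K : numFieldType} {X : normedModType K}.

HB.instance Definition _ := [isSub for @bounded_op_fun K X].
HB.instance Definition _ := [Choice of 'B(X) by <:].
HB.instance Definition _ := [SubChoice_isSubLmodule of 'B(X) by <:].

HB.instance Definition _ (T : 'B(X)) :=
  GRing.isLinear.Build K X X *:%R T (proj1 (bounded_linearP _ (bounded_opP T))).

Definition bounded_op_one : 'B(X) := BoundedOp bounded_linear_id.

Definition bounded_op_mul (S T : 'B(X)) : 'B(X) :=
  BoundedOp (bounded_linear_comp (bounded_opP S) (bounded_opP T)).

Lemma bounded_op_eqP (S T : 'B(X)) : (forall x, S x = T x) -> S = T.
Proof. by move=> ST; apply/val_inj/funext. Qed.

Fact bounded_op_mulA : associative bounded_op_mul.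
Proof. by move=> S T U; apply: bounded_op_eqP. Qed.

Fact bounded_op_mul1l : left_id bounded_op_one bounded_op_mul.
Proof. by move=> S; apply: bounded_op_eqP. Qed.

Fact bounded_op_mul1r : right_id bounded_op_one bounded_op_mul.
Proof. by move=> S; apply: bounded_op_eqP. Qed.

Fact bounded_op_mulDl : left_distributive bounded_op_mul +%R.
Proof. by move=> S T U; apply: bounded_op_eqP. Qed.

Fact bounded_op_mulDr : right_distributive bounded_op_mul +%R.
Proof. by move=> S T U; apply: bounded_op_eqP => x; apply: (linearD S). Qed.

(* 'B(X) is only a possibly zero ring, because X = 0 is allowed; hence it
   cannot be given the library's algType structure. *)
HB.instance Definition _ := GRing.Zmodule_isPzRing.Build 'B(X)
  bounded_op_mulA bounded_op_mul1l bounded_op_mul1r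
  bounded_op_mulDl bounded_op_mulDr.

End BoundedOperatorAlgebra.

(* An algebra homomorphism is not assumed to be unital or continuous. *)
Definition algebra_hom (K : numFieldType) (X Y : normedModType K)
    (psi : 'B(X) -> 'B(Y)) : Prop :=
  linear psi /\ {morph psi : S T / S * T}.

Definition SHAI (K : numFieldType) (X : completeNormedModType K) : Prop :=
  forall Y : completeNormedModType K, (exists y : Y, y != 0) ->
  forall psi : 'B(X) -> 'B(Y), algebra_hom psi ->
    (forall T : 'B(Y), exists S : 'B(X), psi S = T) -> injective psi.

HB.mixin Record NormedModule_isInnerProduct (C : numClosedFieldType) H
    & NormedModule C H := {
  inner : {dot H for (@Num.conj C)};
  inner_normE : forall x : H, inner x x = `|x| ^+ 2 }.

#[short(type="hilbertType")]
HB.structure Definition Hilbert (C : numClosedFieldType) :=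
  {H of CompleteNormedModule C H & NormedModule_isInnerProduct C H}.

(* Main.v *)
Require Import Defs.
From mathcomp Require Import all_boot all_order all_algebra.
From mathcomp Require Import sesquilinear complex ring lra.
From mathcomp Require Import all_classical reals topology tvs normedtype.

(** A bounded operator algebra on a nonzero Banach space [Y] has idempotents [e]
whose corner [e 'B(Y) e] is one-dimensional: those of rank one, which exist by
the Hahn-Banach theorem ([rank_one_idempotent]). For a Hilbert space [H] and a
nonzero ideal [J] of ['B(H)], the quotient by [J] has no such idempotent, since
every projection is, up to a rank-one operator, the sum of two orthogonal
equivalent projections ([halving]), and [J] contains the rank-one operators
([hom_rank_one]). The quotient by the kernel of a surjective homomorphism to
['B(Y)] being ['B(Y)] itself, that kernel must vanish.

What remains is to pass from an arbitrary idempotent [e] of the quotient to a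
projection. Let [psi] be the homomorphism and [psi S = e]. There is a closed
subspace [M] such that [nrm (S h) >= nrm h / 2] on [M] and
[nrm (S h) <= nrm h / 2] on the orthogonal complement of [M]
([spectral_split]). Let [P] be the projection to [M]. If [psi P] were zero,
then [S * (1 - P)] would be another lift of [e]; its norm is at most [1/2], so
[1 - S * (1 - P)] has a left inverse, hence so has [1 - e], and [e = 0] follows
from [(1 - e) * e = 0]. On the other hand [S] has a left inverse on [M]
([left_inverse_on]), so that [P] is in the ideal generated by [S], and the
corner of [psi P] is one-dimensional like that of [e]. The two halves of [P] are mapped onto each other by a square-zero
operator of its corner; its image is a scalar multiple of [psi P] with square
zero, so it vanishes, and with it both halves.

The subspace [M] plays the role of a spectral subspace of [S^* S]. It comes
from the absolute value of a self-adjoint operator ([op_abs_exists]), which is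
obtained by an iteration converging in norm. The halves of [P] come from
Zorn's lemma, applied to graphs of isometries between orthogonal subspaces of
[M]; this works uniformly in the density character of [H]. *)

Set Implicit Arguments.
Unset Strict Implicit.
Unset Printing Implicit Defensive.

Import Order.TTheory GRing.Theory Num.Theory.

Local Open Scope classical_set_scope.
Local Open Scope ring_scope.
Local Open Scope complex_scope.

(** * The real-valued norm *)

Lemma Re_norm_ge0 (R : rcfType) (z : R[i]) : 0 <= complex.Re `|z|.
Proof. by rewrite -lecR RRe_real ?normr_real//; exact: normr_ge0. Qed.

Lemma Re_norm_le (R : rcfType) (z : R[i]) :
  complex.Re `|z| <= `|complex.Re z| + `|complex.Im z|.
Proof.
rewrite normc_def /= -[leRHS]ger0_norm ?addr_ge0// -[leRHS]sqrtr_sqr.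
apply: ler_wsqrtr.
rewrite sqrrD !real_normK ?num_real// lerD2r lerDl.
by rewrite mulrn_wge0// mulr_ge0.
Qed.

Section RealNorm.
Context {R : realType} {V : normedModType R[i]}.

(** The norm of a complex normed space takes values in [R[i]], whose order is
only partial; its real part is the same number in the ordered field [R], where
real arithmetic applies. *)
Definition nrm (v : V) : R := complex.Re `|v|.

Lemma nrmE (v : V) : `|v| = (nrm v)%:C.
Proof. by rewrite /nrm RRe_real ?normr_real. Qed.

Lemma nrm_ge0 (v : V) : 0 <= nrm v.
Proof. by rewrite -lecR -nrmE; exact: normr_ge0. Qed.

Lemma nrm0 : nrm 0 = 0.
Proof. by rewrite /nrm normr0. Qed.

Lemma nrm0_eq0 (v : V) : nrm v = 0 -> v = 0.
Proof. by move=> v0; apply/eqP; rewrite -normr_eq0 nrmE v0 eqxx. Qed.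

Lemma nrm_gt0 (v : V) : v != 0 -> 0 < nrm v.
Proof.
by move=> v0; rewrite lt0r nrm_ge0 andbT; apply: contraNneq v0 => /nrm0_eq0 ->.
Qed.

Lemma nrmN (v : V) : nrm (- v) = nrm v.
Proof. by rewrite /nrm normrN. Qed.

Lemma nrmZ (a : R[i]) (v : V) : nrm (a *: v) = complex.Re `|a| * nrm v.
Proof.
apply: complexI; rewrite -nrmE normrZ nrmE rmorphM /=.
by congr (_ * _); rewrite RRe_real ?normr_real.
Qed.

Lemma nrmZR (a : R) (v : V) : nrm (a%:C *: v) = `|a| * nrm v.
Proof. by rewrite nrmZ normc_def /= expr0n addr0 sqrtr_sqr. Qed.

Lemma nrmD (u v : V) : nrm (u + v) <= nrm u + nrm v.
Proof. by rewrite -lecR rmorphD /= -!nrmE ler_normD. Qed.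

Lemma nrm_distC (u v : V) : nrm (u - v) = nrm (v - u).
Proof. by rewrite -nrmN opprB. Qed.

Lemma nrm_dist (w u v : V) : nrm (u - v) <= nrm (u - w) + nrm (w - v).
Proof. by rewrite (le_trans _ (nrmD _ _))// addrA subrK. Qed.

Lemma nrm_sub_le0 (u v : V) : nrm (u - v) <= 0 -> u = v.
Proof.
move=> uv; apply/eqP; rewrite -subr_eq0; apply/eqP/nrm0_eq0/le_anti.
by rewrite uv nrm_ge0.
Qed.

End RealNorm.

Lemma ler_of_eps (R : realType) (a b C : R) :
  (forall e, 0 < e -> a <= b + C * e) -> a <= b.
Proof.
move=> H; rewrite leNgt; apply/negP => ba.
have CD := ler_norm C.
have D0 : 0 < 2 * (`|C| + 1) by rewrite mulr_gt0 ?ltr_wpDl.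
have e0 : 0 < (a - b) / (2 * (`|C| + 1)) by rewrite divr_gt0 ?subr_gt0.
have := H _ e0; have : (a - b) / (2 * (`|C| + 1)) * (2 * (`|C| + 1)) = a - b.
  by rewrite divfK ?gt_eqF.
move: e0; set e := (X in 0 < X) => e0.
nra.
Qed.

(** Completeness in a form adapted to existence proofs: [F e] is a set of
[e]-approximate solutions, any two of which are close to each other; the limit
is then within [e] of every [e]-approximate solution. *)
Lemma complete_family (R : realType) (V : completeNormedModType R[i])
    (F : R -> set V) :
  (forall e, 0 < e -> exists v, F e v) ->
  (forall e d u v, 0 < e -> 0 < d -> F e u -> F d v -> nrm (u - v) <= e + d) ->
  exists l, forall e v, 0 < e -> F e v -> nrm (l - v) <= e.
Proof.
move=> F0 FF.
have n0 (n : nat) : 0 < n.+1%:R^-1 :> R by rewrite invr_gt0.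
have /choice [u Fu] : forall n : nat, exists v, F n.+1%:R^-1 v.
  by move=> n; exact: F0.
have small (e : R) : 0 < e -> exists N, forall n, (N <= n)%N -> n.+1%:R^-1 < e.
  move=> e0; exists (Num.truncn e^-1) => n Nn.
  rewrite invf_plt ?posrE//.
  by rewrite (lt_le_trans (truncnS_gt _))// ler_nat.
have ucauchy : cvg (u @ \oo).
  apply: cauchy_cvg; apply/cauchy_ballP => e e0.
  have eE : e = (complex.Re e)%:C by rewrite RRe_real// gtr0_real.
  have /small[N HN] : 0 < complex.Re e / 2 by rewrite divr_gt0// -ltcR -eE.
  pose tail := [set u n | n in [set n | (N <= n)%N]].
  exists (tail, tail); first by split; exists N => // n Nn; exists n.
  move=> [_ _] [/= [n Nn <-] [m Nm <-]].
  rewrite -ball_normE /=. rewrite nrmE eE ltcR.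
  apply: le_lt_trans (FF _ _ _ _ (n0 n) (n0 m) (Fu n) (Fu m)) _.
  by rewrite [ltRHS]splitr ltrD ?HN.
exists (lim (u @ \oo)) => e v e0 Fv.
apply: (@ler_of_eps _ _ _ 3) => d d0.
have /small[N HN] := d0.
have := ucauchy => /cvgrPdist_lt /(_ d%:C); rewrite ltcR => /(_ d0) [N' _ HN'].
have /= := HN' (maxn N N') (leq_maxr _ _).
have := HN (maxn N N') (leq_maxl _ _).
set n := maxn N N'; move=> nd; rewrite nrmE ltcR => ld.
have := nrm_dist (u n) (lim (u @ \oo)) v.
move: nd (FF _ _ _ _ (n0 n) e0 (Fu n) Fv); move: (_^-1) => a; lra.
Qed.

(** * Bounded operators *)

Section BoundedOperatorsReal.
Context {R : realType} {V : normedModType R[i]}.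
Implicit Types (S T : 'B(V)) (h : V).

Lemma opDE S T h : (S + T) h = S h + T h. Proof. by []. Qed.
Lemma opNE T h : (- T) h = - T h. Proof. by []. Qed.
Lemma opBE S T h : (S - T) h = S h - T h. Proof. by []. Qed.
Lemma opZE a T h : (a *: T) h = a *: T h. Proof. by []. Qed.
Lemma opME S T h : (S * T) h = S (T h). Proof. by []. Qed.
Lemma op1E h : (1 : 'B(V)) h = h. Proof. by []. Qed.
Lemma op0E h : (0 : 'B(V)) h = 0. Proof. by []. Qed.

(* [opBE] comes before [opDE], which also matches a difference. *)
Definition opE := (opBE, opDE, opNE, opZE, opME, op1E, op0E).

Lemma opB T u v : T (u - v) = T u - T v.
Proof. by rewrite linearB. Qed.

Lemma opZAl a S T : (a *: S) * T = a *: (S * T).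
Proof. exact: bounded_op_eqP. Qed.

Lemma opZAr a S T : S * (a *: T) = a *: (S * T).
Proof. by apply: bounded_op_eqP => y; rewrite !opE linearZ. Qed.

Lemma bounded_op_bound (T : 'B(V)) :
  exists2 M : R, 0 < M & forall x, nrm (T x) <= M * nrm x.
Proof.
have [M M0 TM] := bounded_linear_ge0 (bounded_opP T).
have ME : M = (complex.Re M)%:C by rewrite RRe_real// ger0_real.
exists (complex.Re M + 1); first by rewrite ltr_wpDl// -lecR -ME.
move=> x; rewrite mulrDl mul1r ler_wpDr ?nrm_ge0// -lecR rmorphM/= -ME -!nrmE.
exact: TM.
Qed.

Lemma bounded_op_of (f : V -> V) (M : R) :
  (forall a u v, f (a *: u + v) = a *: f u + f v) ->
  (forall x, nrm (f x) <= M * nrm x) ->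
  exists T : 'B(V), forall x, T x = f x.
Proof.
move=> fl fM; suff fB : f \in bounded_linear by exists (BoundedOp fB).
apply/bounded_linearP; split; first exact: fl.
by exists M%:C => x; rewrite !nrmE -rmorphM /= lecR; exact: fM.
Qed.

End BoundedOperatorsReal.

(** [Zorn_bigcup] also asks for the union of the empty chain; looking only at
sets of the form [A0 `|` A] replaces that union by [A0]. *)
Lemma Zorn_above (T : Type) (P : set (set T)) (A0 : set T) : P A0 ->
  (forall F : set (set T), F `<=` P -> F !=set0 -> total_on F subset ->
     P (\bigcup_(X in F) X)) ->
  exists A, [/\ A0 `<=` A, P A & forall B, A `<=` B -> P B -> B `<=` A].
Proof.
move=> PA0 PF.
have : exists A, P (A0 `|` A) /\ forall B, A `<` B -> ~ P (A0 `|` B).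
  apply: (@Zorn_bigcup T [set A | P (A0 `|` A)]) => F FP Ftot /=.
  have [->|/set0P[X0 FX0]] := eqVneq F set0.
    by rewrite bigcup_set0 setU0.
  have -> : A0 `|` \bigcup_(X in F) X = \bigcup_(Y in [set A0 `|` X | X in F]) Y.
    apply/seteqP; split=> [x [A0x|[X FX Xx]]|x [_ [X FX <-] [A0x|Xx]]].
    - by exists (A0 `|` X0); [exists X0|left].
    - by exists (A0 `|` X); [exists X|right].
    - by left.
    - by right; exists X.
  apply: PF => [_ [X FX <-]||_ _ [X FX <-] [Y FY <-]]; first exact: FP.
    by exists (A0 `|` X0), X0.
  by have [?|?] := Ftot _ _ FX FY; [left|right]; exact: setUS.
move=> [A [PA Amax]]; exists (A0 `|` A); split=> // B AB PB.
apply: contrapT => nBA; apply: (Amax B); last first.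
  rewrite /= (_ : A0 `|` B = B)//; apply: setUidr.
  by apply: subset_trans AB; exact: subsetUl.
split; first by apply: subset_trans AB; exact: subsetUr.
by apply: contra_not nBA => /subset_trans; apply; exact: subsetUr.
Qed.

(** * Norming functionals and rank-one idempotents *)

Lemma functional_scale (K : pzRingType) (V : lmodType K) (f : V -> K) :
  (forall a u v, f (a *: u + v) = a * f u + f v) -> forall a u, f (a *: u) = a * f u.
Proof.
move=> fl a u; have f0 : f 0 = 0.
  by have := fl (-1) 0 0; rewrite scaler0 addr0 mulN1r addNr.
by rewrite -[_ *: _]addr0 fl f0 addr0.
Qed.

Section HahnBanach.
Context {R : realType} {Y : normedModType R[i]}.

(** A real-linear functional on a real subspace, dominated by the norm, is
encoded by its graph, so that unions of chains need no gluing. That [A] is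
the graph of a function follows: a pair [(0, r)] of [A] has [r <= 0] and
[- r <= 0]. *)
Definition dominated_graph (A : set (Y * R)) :=
  (forall (a : R) u v r s, A (u, r) -> A (v, s) -> A (a%:C *: u + v, a * r + s))
  /\ (forall u r, A (u, r) -> r <= nrm u).

(** The extension step of the Hahn-Banach theorem. A value [r] at [y] is
admissible as soon as [s - nrm (u - y) <= r <= nrm (v + y) - t] for all
[(u, s)] and [(v, t)] in [A], and the triangle inequality puts every left-hand
side below every right-hand side. *)
Lemma dominated_graph_extend (A : set (Y * R)) (y : Y) :
  A (0, 0) -> dominated_graph A ->
  exists r, exists2 B, dominated_graph B & A `<=` B /\ B (y, r).
Proof.
move=> A0 [Alin Adom].
have AZ (a : R) u r : A (u, r) -> A (a%:C *: u, a * r).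
  by move=> Aur; rewrite -[_ *: _]addr0 -[_ * _]addr0; exact: Alin.
pose L : set R := [set x | exists u s, A (u, s) /\ x = s - nrm (u - y)].
have Lle v t : A (v, t) -> ubound L (nrm (v + y) - t).
  move=> Avt _ [u [s [Aus ->]]].
  have := Adom _ _ (Alin 1 _ _ _ _ Aus Avt).
  rewrite rmorph1 scale1r mul1r.
  have := nrmD (u - y) (v + y); rewrite addrACA addNr addr0; lra.
have L0 : L !=set0 by exists (0 - nrm (0 - y)), 0, 0.
have Lsup : has_sup L by split=> //; eexists; exact: Lle A0.
pose r := sup L.
have rge u s : A (u, s) -> s - nrm (u - y) <= r.
  by move=> Aus; apply: ub_le_sup; [exact: Lsup.2|exists u, s].
have rle v t : A (v, t) -> r <= nrm (v + y) - t.
  by move=> Avt; apply: ge_sup => //; exact: Lle.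
exists r, [set p | exists u s a, A (u, s) /\ p = (u + a%:C *: y, s + a * r)].
  split=> [a _ _ _ _ [u [s [c [Aus [-> ->]]]]] [v [t [d [Avt [-> ->]]]]]|].
    exists (a%:C *: u + v), (a * s + t), (a * c + d); split; first exact: Alin.
    congr (_, _); last by ring.
    by rewrite rmorphD rmorphM /= scalerDl scalerDr scalerA addrACA.
  (* For a != 0, dividing u + a y by |a| reduces to the coefficients 1 and -1. *)
  move=> _ _ [u [s [a [Aus [-> ->]]]]]; have [a0|a0|->] := ltgtP a 0; last first.
  - by rewrite rmorph0 scale0r mul0r !addr0; exact: Adom.
  - have := rle _ _ (AZ a^-1 _ _ Aus).
    have -> : a^-1%:C *: u + y = a^-1%:C *: (u + a%:C *: y).
      by rewrite scalerDr scalerA -rmorphM mulVf ?gt_eqF// rmorph1 scale1r.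
    rewrite nrmZR gtr0_norm ?invr_gt0// -mulrBr -[a^-1 * _]mulrC ler_pdivlMr//.
    by rewrite mulrC; lra.
  - have := rge _ _ (AZ (- a^-1) _ _ Aus).
    have -> : (- a^-1)%:C *: u - y = (- a^-1)%:C *: (u + a%:C *: y).
      by rewrite scalerDr scalerA -rmorphM mulNr mulVf ?lt_eqF// rmorphN1 scaleN1r.
    rewrite nrmZR gtr0_norm ?oppr_gt0 ?invr_lt0// -mulrBr mulNr -mulrN mulrC.
    by rewrite ler_ndivrMr// mulrC; lra.
split=> [[u s] Aus|].
  by exists u, s, 0; rewrite rmorph0 scale0r mul0r !addr0.
by exists 0, 0, 1; rewrite rmorph1 scale1r mul1r !add0r.
Qed.

(** The complex Hahn-Banach theorem for a single vector: a real-linear [g] with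
[g y0 = nrm y0], dominated by the norm, is the real part of the complex-linear
functional [y |-> g y - i g (i y)], whose modulus is at most [2 * nrm y]. *)
Lemma norming_functional (y0 : Y) : y0 != 0 ->
  exists f : Y -> R[i],
  [/\ forall a u v, f (a *: u + v) = a * f u + f v,
      exists M : R, forall y, complex.Re `|f y| <= M * nrm y & f y0 = 1].
Proof.
move=> y00.
have [| |A [lineA Agr Amax]] := @Zorn_above _ dominated_graph
    [set p | exists a : R, p = (a%:C *: y0, a * nrm y0)].
- split=> [a _ _ _ _ [b [-> ->]] [c [-> ->]]|_ _ [a [-> ->]]].
    by exists (a * b + c); rewrite rmorphD rmorphM /= scalerDl scalerA mulrDl mulrA.
  by rewrite nrmZR ler_wpM2r ?nrm_ge0// ler_norm.
- move=> F FP [X0 FX0] Ftot; split=> [a u v r s [X FX Xu] [Z FZ Zv]|u r [X FX Xu]].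
    have [XZ|ZX] := Ftot _ _ FX FZ.
      by exists Z => //; apply: (FP _ FZ).1 => //; exact: XZ.
    by exists X => //; apply: (FP _ FX).1 => //; exact: ZX.
  exact: (FP _ FX).2.
have A0 : A (0, 0).
  by apply: lineA; exists 0; rewrite rmorph0 scale0r mul0r.
have Atot y : exists r, A (y, r).
  have [r [B Bgr [AB By]]] := dominated_graph_extend y A0 Agr.
  by exists r; apply: Amax By.
have [g Ag] := choice Atot.
case: Agr => Alin Adom.
have Afun y r : A (y, r) -> r = g y.
  move=> Ayr; apply/eqP; rewrite eq_le; apply/andP; split.
    have := Adom _ _ (Alin (-1) _ _ _ _ (Ag y) Ayr).
    by rewrite rmorphN1 scaleN1r addNr nrm0; lra.
  have := Adom _ _ (Alin (-1) _ _ _ _ Ayr (Ag y)).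
  by rewrite rmorphN1 scaleN1r addNr nrm0; lra.
have glin (a : R) u v : g (a%:C *: u + v) = a * g u + g v.
  by apply/esym/Afun/Alin.
have g0 : g 0 = 0 by apply/esym/Afun.
have gZ (a : R) u : g (a%:C *: u) = a * g u by rewrite -[_ *: _]addr0 glin g0 addr0.
have gle y : `|g y| <= nrm y.
  rewrite ler_norml Adom // andbT lerNl.
  have := Adom _ _ (Ag (- y)); rewrite nrmN; apply: le_trans.
  by rewrite -scaleN1r -(rmorph1 (real_complex R)) -rmorphN gZ mulN1r.
have gy0 : g y0 = nrm y0.
  by apply/esym/Afun/lineA; exists 1; rewrite rmorph1 scale1r mul1r.
have gD u v : g (u + v) = g u + g v.
  by have := glin 1 u v; rewrite rmorph1 scale1r mul1r.
have gN u : g (- u) = - g u.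
  by rewrite -scaleN1r -(rmorphN1 (real_complex R)) gZ mulN1r.
have gc a w : g (a *: w) = complex.Re a * g w + complex.Im a * g ('i *: w).
  rewrite -[_ * g ('i *: w)]gZ -glin; congr g.
  by rewrite [in LHS](complexE a) scalerDl scalerA mulrC.
pose h (y : Y) : R[i] := Complex (g y) (- g ('i *: y)).
have hlin a u v : h (a *: u + v) = a * h u + h v.
  have gi w : g ('i *: ('i *: w)) = - g w.
    by rewrite scalerA -expr2 sqr_i scaleN1r gN.
  rewrite /h gD (gc a u) scalerDr gD scalerA ['i * a]mulrC -scalerA.
  rewrite (gc a ('i *: u)) gi.
  case: a => x z; apply/eqP; rewrite eq_complex /=.
  by apply/andP; split; apply/eqP; ring.
have hbd y : complex.Re `|h y| <= 2 * nrm y.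
  apply: le_trans (Re_norm_le _) _; rewrite /= normrN.
  have : nrm ('i *: y) = nrm y.
    by rewrite nrmZ normc_def /= expr0n add0r expr1n sqrtr1 mul1r.
  by have := gle y; have := gle ('i *: y); lra.
have hy0 : h y0 != 0.
  rewrite eq_complex /= gy0 negb_and; apply/orP; left.
  by rewrite gt_eqF// nrm_gt0.
exists (fun y => h y / h y0); split=> [a u v||]; last by rewrite divff.
  by rewrite hlin mulrDl mulrA.
exists (2 * complex.Re `|(h y0)^-1|) => y.
have ReM (a b : R[i]) :
    complex.Re (`|a| * `|b|) = complex.Re `|a| * complex.Re `|b|.
  by rewrite !normc_def -rmorphM.
by rewrite normrM ReM mulrAC ler_wpM2r// Re_norm_ge0.
Qed.

(** The idempotent is [y |-> f y *: y0] with [f y0 = 1]. The corner that it cuts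
out of the algebra is one-dimensional, which is the property of ['B(Y)] that
is played off against the algebra of operators on a Hilbert space. *)
Lemma rank_one_idempotent (y0 : Y) : y0 != 0 -> exists2 e : 'B(Y),
  e != 0 & e * e = e /\ forall T : 'B(Y), exists a, e * T * e = a *: e.
Proof.
move=> y00; have [f [flin [M fM] fy0]] := norming_functional y00.
have [|x|e eE] := @bounded_op_of _ Y (fun y => f y *: y0) (M * nrm y0).
- by move=> a u v; rewrite flin scalerDl scalerA.
- by rewrite nrmZ mulrAC ler_wpM2r ?nrm_ge0.
have fZ := functional_scale flin.
exists e.
  by apply: contra_neq y00 => e0; have := eE y0; rewrite e0 fy0 scale1r.
split=> [|T]; first by apply: bounded_op_eqP => y; rewrite /= !eE fZ fy0 mulr1.
exists (f (T y0)); apply: bounded_op_eqP => y.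
change (e (T (e y)) = f (T y0) *: e y).
by rewrite !eE linearZ fZ scalerA mulrC.
Qed.

End HahnBanach.

(** * The inner product and orthogonal projections *)

Section InnerProduct.
Context {R : realType} {H : hilbertType R[i]}.
Implicit Types (u v w : H) (a : R[i]).

Definition re u v : R := complex.Re (inner u v).

Lemma inner_sym u v : inner u v = (inner v u)^*%C.
Proof. by rewrite hermC expr0 mul1r. Qed.

Lemma innerZl a u v : inner (a *: u) v = a * inner u v.
Proof. by rewrite linearZl_LR. Qed.

Lemma innerZr a u v : inner u (a *: v) = a^*%C * inner u v.
Proof. by rewrite inner_sym innerZl rmorphM /= -inner_sym. Qed.

Lemma inner_nrm u : inner u u = (nrm u ^+ 2)%:C.
Proof. by rewrite inner_normE nrmE rmorphXn. Qed.

Lemma re_nrm u : re u u = nrm u ^+ 2.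
Proof. by rewrite /re inner_nrm. Qed.

Lemma reC u v : re u v = re v u.
Proof. by rewrite /re inner_sym; case: (inner v u). Qed.

Lemma reDl u v w : re (u + v) w = re u w + re v w.
Proof. by rewrite /re linearDl raddfD. Qed.

Lemma reNl u v : re (- u) v = - re u v.
Proof. by rewrite /re linearNl raddfN. Qed.

Lemma reBl u v w : re (u - v) w = re u w - re v w.
Proof. by rewrite reDl reNl. Qed.

Lemma reDr u v w : re u (v + w) = re u v + re u w.
Proof. by rewrite reC reDl !(reC u). Qed.

Lemma reNr u v : re u (- v) = - re u v.
Proof. by rewrite reC reNl reC. Qed.

Lemma reBr u v w : re u (v - w) = re u v - re u w.
Proof. by rewrite reDr reNr. Qed.

Lemma reZl (t : R) u v : re (t%:C *: u) v = t * re u v.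
Proof. by rewrite /re innerZl; case: (inner u v) => x y /=; ring. Qed.

Lemma reZr (t : R) u v : re u (t%:C *: v) = t * re u v.
Proof. by rewrite reC reZl reC. Qed.

Lemma nrmD_sqr u v : nrm (u + v) ^+ 2 = nrm u ^+ 2 + nrm v ^+ 2 + 2 * re u v.
Proof. by rewrite -!re_nrm reDl !reDr (reC v u); ring. Qed.

Lemma nrmB_sqr u v : nrm (u - v) ^+ 2 = nrm u ^+ 2 + nrm v ^+ 2 - 2 * re u v.
Proof. by rewrite nrmD_sqr nrmN reNr; ring. Qed.

(** The norm being given, the Cauchy-Schwarz inequality is the triangle
inequality squared. *)
Lemma re_le u v : re u v <= nrm u * nrm v.
Proof.
have := nrmD_sqr u v; have := nrmD u v.
have := nrm_ge0 u; have := nrm_ge0 v; have := nrm_ge0 (u + v); nra.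
Qed.

Lemma re_le_abs u v : `|re u v| <= nrm u * nrm v.
Proof.
by rewrite ler_norml re_le andbT lerNl -reNr -(nrmN v) re_le.
Qed.

Lemma inner_eq0 u v : (forall a, re u (a *: v) = 0) -> inner u v = 0.
Proof.
move=> /(_ (inner u v)); rewrite /re innerZr.
case: (inner u v) => x y /= xy; apply/eqP; rewrite eq_complex /=.
have : x * x + y * y = 0 by lra.
have := sqr_ge0 x; have := sqr_ge0 y; rewrite !expr2 => yy xx s.
rewrite -[x == 0](sqrf_eq0 x) -[y == 0](sqrf_eq0 y) !expr2.
by apply/andP; split; apply/eqP; lra.
Qed.

(** The case of complex values: rotate [v] so that the inner product is real. *)
Lemma inner_le u v : complex.Re `|inner u v| <= nrm u * nrm v.
Proof.
have := re_le u (inner u v *: v); rewrite /re innerZr mulrC nrmZ.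
have -> : inner u v * (inner u v)^*%C = (complex.Re `|inner u v| ^+ 2)%:C.
  by rewrite -sqr_normc -[in LHS](RRe_real (normr_real _)) rmorphXn.
set n := complex.Re `|inner u v|; move=> le.
have n0 : 0 <= n := Re_norm_ge0 _.
move: n0; rewrite le_eqVlt => /predU1P[<-|n0].
  by rewrite mulr_ge0 ?nrm_ge0.
by move: (le : n ^+ 2 <= _); rewrite mulrCA expr2 ler_pM2l.
Qed.

Lemma inner_eq0C u v : inner u v = 0 -> inner v u = 0.
Proof. by move=> uv; rewrite inner_sym uv rmorph0. Qed.

End InnerProduct.

Section Subspaces.
Context {R : realType} {V : normedModType R[i]}.

Definition linear_subspace (M : set V) :=
  M 0 /\ forall a u v, M u -> M v -> M (a *: u + v).

(** Topological closedness of a subspace, in terms of approximation. *)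
Definition closed_subspace (M : set V) := linear_subspace M /\
  forall x, (forall e : R, 0 < e -> exists2 m, M m & nrm (x - m) <= e) -> M x.

Lemma linear_subspaceZ M a u : linear_subspace M -> M u -> M (a *: u).
Proof. by move=> [M0 Ml] Mu; rewrite -[_ *: _]addr0; exact: Ml. Qed.

Lemma linear_subspaceD M u v : linear_subspace M -> M u -> M v -> M (u + v).
Proof. by move=> [M0 Ml] Mu Mv; rewrite -[u]scale1r; exact: Ml. Qed.

Lemma linear_subspaceB M u v : linear_subspace M -> M u -> M v -> M (u - v).
Proof. by move=> Ms Mu Mv; rewrite addrC -scaleN1r; exact: Ms.2. Qed.

Lemma closed_kernel (T : 'B(V)) : closed_subspace [set x | T x = 0].
Proof.
split=> [|x Hx].
  split=> [|a u v /= Tu Tv]; first exact: linear0.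
  by rewrite linearD linearZ /= Tu Tv scaler0 addr0.
have [M M0 TM] := bounded_op_bound T.
apply: nrm0_eq0; apply: le_anti; rewrite nrm_ge0 andbT.
apply: (@ler_of_eps _ _ _ M) => e /Hx[m Tm xm].
rewrite add0r (le_trans _ (ler_wpM2l (ltW M0) xm))//.
by rewrite (le_trans _ (TM _))// linearB /= Tm subr0.
Qed.

End Subspaces.

Section Projection.
Context {R : realType} {H : hilbertType R[i]}.
Implicit Types (M : set H).

Definition projector (M : set H) (P : 'B(H)) :=
  (forall h, M (P h)) /\ forall h m, M m -> inner (h - P h) m = 0.

(** By the parallelogram identity, two points of [M] whose squared distances to
[h] exceed the infimum [d ^+ 2] by at most [e ^+ 2 / 2] and [c ^+ 2 / 2] are
within [e + c] of each other. *)
Lemma nearest_point M (h : H) : closed_subspace M ->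
  exists2 l, M l & forall m, M m -> nrm (h - l) <= nrm (h - m).
Proof.
move=> [Ms Mc]; pose D : set R := [set nrm (h - m) | m in M].
have D0 : has_inf D.
  split; first by exists (nrm (h - 0)), 0 => //; exact: Ms.1.
  by exists 0 => _ [m _ <-]; exact: nrm_ge0.
pose d := inf D.
have dle m : M m -> d <= nrm (h - m).
  by move=> Mm; apply: ge_inf; [exact: D0.2|exists m].
have d0 : 0 <= d.
  by apply: lb_le_inf; [exact: D0.1|move=> _ [m _ <-]; exact: nrm_ge0].
pose F (e : R) : set H := [set m | M m /\ nrm (h - m) ^+ 2 <= d ^+ 2 + e ^+ 2 / 2].
have Fd e m : 0 < e -> F e m -> nrm (h - m) <= d + e.
  move=> e0 [_ hm]; have := nrm_ge0 (h - m); nra.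
have Fex e : 0 < e -> exists m, F e m.
  move=> e0; pose s := Num.sqrt (d ^+ 2 + e ^+ 2 / 2).
  have s2 : s ^+ 2 = d ^+ 2 + e ^+ 2 / 2.
    by rewrite sqr_sqrtr// addr_ge0 ?sqr_ge0// divr_ge0 ?sqr_ge0.
  have s0 : 0 <= s by exact: sqrtr_ge0.
  have ds : d < s by nra.
  have [_ [m Mm <-] hm] := inf_lt D0.1 ds.
  exists m; split=> //; rewrite -s2.
  by have := nrm_ge0 (h - m); nra.
have [l lF] : exists l, forall e m, 0 < e -> F e m -> nrm (l - m) <= e.
  apply: complete_family => // e c u v e0 c0 [Mu hu] [Mv hv].
  set t := nrm (h - 2^-1%:C *: (u + v)).
  have dt : d <= t by exact: dle (linear_subspaceZ _ Ms (linear_subspaceD Ms Mu Mv)).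
  have st : nrm ((h - u) + (h - v)) = 2 * t.
    have -> : (h - u) + (h - v) = (2 : R)%:C *: (h - 2^-1%:C *: (u + v)).
      rewrite scalerBr scalerA -rmorphM mulfV ?pnatr_eq0// rmorph1 scale1r.
      by rewrite rmorphMn rmorph1 scaler_nat mulr2n addrACA opprD.
    by rewrite nrmZR ger0_norm.
  have := nrmD_sqr (h - u) (h - v); have := nrmB_sqr (h - u) (h - v).
  have -> : (h - u) - (h - v) = v - u by rewrite opprB addrC subrKA.
  rewrite (nrm_distC v) st => au sq.
  suff : nrm (u - v) ^+ 2 <= (e + c) ^+ 2.
    by rewrite ler_sqr ?nnegrE ?nrm_ge0 ?addr_ge0// ltW.
  nra.
have Ml : M l.
  apply: Mc => e e0; have [m Fm] := Fex _ e0.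
  by exists m; [exact: Fm.1|exact: lF].
exists l => // m Mm; apply: le_trans (dle _ Mm).
apply: (@ler_of_eps _ _ _ 2) => e e0; have [k Fk] := Fex _ e0.
have := nrm_dist k h l; have := lF _ _ e0 Fk; have := Fd _ _ e0 Fk.
by rewrite (nrm_distC l); lra.
Qed.

End Projection.

Section Projectors.
Context {R : realType} {H : hilbertType R[i]}.
Implicit Types (M : set H) (P Q S T : 'B(H)) (h u v : H).

(** With [l] nearest to [h] and [m] in [M], the function
[t |-> nrm (h - l - t m) ^+ 2] of the real variable [t] is minimal at [0], so
its derivative [- 2 * re (h - l) m] vanishes; [t = r / K] is a value at which
a nonzero derivative [r] would show. *)
Lemma orthogonal_decomposition M h : closed_subspace M ->
  exists2 l, M l & forall m, M m -> inner (h - l) m = 0.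
Proof.
move=> Mc; have [l Ml lmin] := nearest_point h Mc; exists l => // m Mm.
apply: inner_eq0 => a.
have {m a Mm}[m Mm ->] : exists2 m', M m' & a *: m = m'.
  by exists (a *: m) => //; exact: linear_subspaceZ Mc.1 Mm.
set r := re _ _; pose K := nrm m ^+ 2 + 1.
have K0 : 0 < K by rewrite ltr_wpDl ?sqr_ge0.
have rE : r = r / K * K by rewrite divfK ?gt_eqF.
have := lmin _ (linear_subspaceD Mc.1 Ml (linear_subspaceZ (r / K)%:C Mc.1 Mm)).
rewrite -ler_sqr ?nnegrE ?nrm_ge0// opprD addrA (nrmB_sqr (h - l)) reZr nrmZR -/r.
rewrite exprMn real_normK ?num_real//.
move: (r / K) rE => t; rewrite /K => rE.
have : 0 <= nrm m ^+ 2 by exact: sqr_ge0.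
set n := nrm m ^+ 2 in rE *; move: (nrm (h - l) ^+ 2) => d n0.
move=> le; suff : t ^+ 2 <= 0.
  rewrite le_eqVlt ltNge sqr_ge0 orbF sqrf_eq0 => /eqP t0.
  by rewrite rE t0 mul0r.
have := sqr_ge0 t; nra.
Qed.

Lemma projector_exists M : closed_subspace M -> exists P, projector M P.
Proof.
move=> Mc; have [p pP] := choice (fun h => let: ex_intro2 l Ml lP :=
  orthogonal_decomposition h Mc in ex_intro _ l (conj Ml lP)).
have puniq h l : M l -> (forall m, M m -> inner (h - l) m = 0) -> p h = l.
  move=> Ml lP; have [Mp pO] := pP h.
  have : inner (p h - l) (p h - l) = 0.
    have Md := linear_subspaceB Mc.1 Mp Ml.
    have E : p h - l = (h - l) - (h - p h) by rewrite opprB [RHS]addrC subrKA.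
    by rewrite {1}E linearBl /= lP// pO// subrr.
  rewrite inner_nrm => /complexI/eqP; rewrite sqrf_eq0 => /eqP/nrm0_eq0/eqP.
  by rewrite subr_eq0 => /eqP.
have [||P PE] := @bounded_op_of _ H p 1.
- move=> a u v; have [Mu uO] := pP u; have [Mv vO] := pP v.
  apply: puniq => [|m Mm]; first exact: Mc.1.2.
  have -> : a *: u + v - (a *: p u + p v) = a *: (u - p u) + (v - p v).
    by rewrite opprD addrACA scalerBr.
  by rewrite linearDl /= innerZl uO// vO// mulr0 addr0.
- move=> h; have [Mh hO] := pP h; rewrite mul1r -ler_sqr ?nnegrE ?nrm_ge0//.
  rewrite -[in leRHS](subrK (p h) h) nrmD_sqr /re hO//= mulr0 addr0.
  by rewrite lerDr sqr_ge0.
by exists P; split=> h; rewrite PE; [exact: (pP h).1|exact: (pP h).2].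
Qed.

Lemma orthogonal_self h : inner h h = 0 -> h = 0.
Proof.
by rewrite inner_nrm => /complexI/eqP; rewrite sqrf_eq0 => /eqP/nrm0_eq0.
Qed.

Lemma projector_id M P h : linear_subspace M -> projector M P -> M h -> P h = h.
Proof.
move=> Ms [PM PO] Mh; apply/eqP; rewrite eq_sym -subr_eq0; apply/eqP.
by apply: orthogonal_self; apply: PO; exact: linear_subspaceB Ms Mh (PM h).
Qed.

Lemma projectorK M P h : linear_subspace M -> projector M P -> P (P h) = P h.
Proof. by move=> Ms pP; apply: (projector_id Ms pP); exact: pP.1. Qed.

Lemma projector_inner M P u v : projector M P -> M v ->
  inner (P u) v = inner u v.
Proof.
move=> [PM PO] Mv; apply/eqP; rewrite eq_sym -subr_eq0 -linearBl/=.
by rewrite PO// eqxx.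
Qed.

Lemma projector_eq0 M P h : linear_subspace M -> projector M P ->
  (forall m, M m -> inner h m = 0) -> P h = 0.
Proof.
move=> Ms PM hO; apply: orthogonal_self.
by rewrite (projector_inner _ PM) ?hO//; exact: PM.1.
Qed.

(** The Riesz representation theorem: a vector orthogonal to the kernel of [f]
represents [f] after rescaling. *)
Lemma riesz (f : H -> R[i]) (C : R) :
  (forall a u v, f (a *: u + v) = a * f u + f v) ->
  (forall h, complex.Re `|f h| <= C * nrm h) ->
  exists y, forall h, f h = inner h y.
Proof.
move=> fl fC.
have fZ := functional_scale fl.
have f0 : f 0 = 0 by rewrite -(scale0r 0) fZ mul0r.
have fB u v : f (u - v) = f u - f v by rewrite addrC -scaleN1r fl mulN1r addrC.
have norm_Re (z : R[i]) : complex.Re `|z| = 0 -> z = 0.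
  by move=> z0; apply/normr0_eq0; rewrite -[LHS]RRe_real ?normr_real// z0.
have [[h0 fh0]|nf] := pselect (exists h, f h != 0); last first.
  exists 0 => h; rewrite linear0r.
  by have [//|fh] := eqVneq (f h) 0; case: nf; exists h.
pose K : set H := [set h | f h = 0].
have Kc : closed_subspace K.
  split=> [|x Hx].
    split=> [//|a u v /= fu fv].
    by rewrite /K /= fl fu fv mulr0 addr0.
  apply: norm_Re; apply: le_anti; rewrite Re_norm_ge0 andbT.
  apply: (@ler_of_eps _ _ _ `|C|) => e /Hx[m Km xm].
  rewrite add0r (le_trans _ (ler_wpM2l _ xm))// -[f x]subr0 -Km -fB.
  by rewrite (le_trans (fC _))// ler_wpM2r ?nrm_ge0 ?ler_norm.
have [k Kk kO] := orthogonal_decomposition h0 Kc.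
pose z := h0 - k.
have fz : f z = f h0 by rewrite fB Kk subr0.
have zz : inner z z != 0.
  apply: contra_neq fh0 => /orthogonal_self z0.
  by rewrite -fz z0.
exists ((f z / inner z z)^*%C *: z) => h.
have : inner z (f z *: h - f h *: z) = 0.
  by apply: kO; rewrite /K /= fB !fZ mulrC subrr.
move=> /inner_eq0C; rewrite linearBl /= !innerZl => /eqP.
rewrite subr_eq0 => /eqP E.
by rewrite innerZr conjcK mulrAC E mulfK.
Qed.

Lemma adjoint_exists T :
  exists T' : 'B(H), forall u v, inner (T u) v = inner u (T' v).
Proof.
have [M M0 TM] := bounded_op_bound T.
have t_ex v : exists y, forall u, inner (T u) v = inner u y.
  apply: (@riesz (fun u => inner (T u) v) (M * nrm v)) => [a u w|h].
    by rewrite linearD linearZ /= linearDl /= innerZl.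
  apply: le_trans (inner_le _ _) _.
  by rewrite mulrAC ler_wpM2r ?nrm_ge0.
have [t tP] := choice t_ex.
have inj u v : (forall w, inner w u = inner w v) -> u = v.
  move=> E; apply/eqP; rewrite -subr_eq0; apply/eqP/orthogonal_self.
  by rewrite linearBr /= E subrr.
have [|v|T' T'E] := @bounded_op_of _ H t M.
- move=> a u v; apply: inj => w; rewrite -tP linearDr /= innerZr linearDr /= innerZr.
  by rewrite !tP.
- have := re_le (T (t v)) v; rewrite /re tP inner_nrm /=.
  have := TM (t v); have := nrm_ge0 v; have := nrm_ge0 (t v).
  rewrite le_eqVlt => /predU1P[<- *|t0 v0 Tt le].
    by rewrite mulr_ge0 ?nrm_ge0 ?ltW.
  rewrite -(ler_pM2l t0) -expr2 (le_trans le)// mulrA [_ * M]mulrC.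
  by rewrite ler_wpM2r.
by exists T' => u v; rewrite T'E tP.
Qed.

(** The image of [M] is closed because [T] is bounded below on [M]; the left
inverse projects onto that image and then inverts [T]. *)
Lemma left_inverse_on M T (c : R) : closed_subspace M -> 0 < c ->
  (forall h, M h -> c * nrm h <= nrm (T h)) ->
  exists Z : 'B(H), forall h, M h -> Z (T h) = h.
Proof.
move=> Mc c0 Tc.
have [B B0 TB] := bounded_op_bound T.
have cI : c^-1 * c = 1 by rewrite mulVf ?gt_eqF.
have nle h : M h -> nrm h <= c^-1 * nrm (T h).
  by move=> /Tc; rewrite ler_pdivlMl.
pose N : set H := [set T h | h in M].
have Nc : closed_subspace N.
  split=> [|y Ny].
    split=> [|a _ _ [u Mu <-] [v Mv <-]].
      by exists 0; [exact: Mc.1.1|exact: linear0].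
    by exists (a *: u + v); [exact: Mc.1.2|rewrite linearD linearZ].
  pose F (e : R) : set H := [set k | M k /\ nrm (y - T k) <= c * e].
  have Fex e : 0 < e -> exists k, F e k.
    move=> e0; have [_ [k Mk <-] yk] := Ny (c * e) (mulr_gt0 c0 e0).
    by exists k.
  have [l lF] : exists l, forall e m, 0 < e -> F e m -> nrm (l - m) <= e.
    apply: complete_family => // e d u v e0 d0 [Mu yu] [Mv yv].
    rewrite -(ler_pM2l c0).
    have := Tc _ (linear_subspaceB Mc.1 Mu Mv); rewrite linearB /=.
    by have := nrm_dist y (T u) (T v); rewrite (nrm_distC (T u) y); lra.
  exists l.
    apply: Mc.2 => e e0; have [m Fm] := Fex _ e0.
    by exists m; [exact: Fm.1|exact: lF].
  apply: nrm_sub_le0; apply: (@ler_of_eps _ _ _ (B + c)) => e e0.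
  have [k Fk] := Fex _ e0; have := lF _ _ e0 Fk; have := Fk.2.
  have := TB (l - k); rewrite linearB /=.
  by have := nrm_dist (T k) (T l) y; rewrite (nrm_distC (T k) y); nra.
have [Q [QN QO]] := projector_exists Nc.
have z_ex y : exists k, M k /\ T k = Q y.
  by have [k Mk kE] := QN y; exists k.
have [z zP] := choice z_ex.
have inj u v : M u -> M v -> T u = T v -> u = v.
  move=> Mu Mv E; apply: nrm_sub_le0.
  apply: le_trans (nle _ (linear_subspaceB Mc.1 Mu Mv)) _.
  by rewrite opB E subrr nrm0 mulr0.
have [B' B'0 QB] := bounded_op_bound Q.
have [|y|Z ZE] := @bounded_op_of _ H z (c^-1 * B').
- move=> a u v; have [Mu Tu] := zP u; have [Mv Tv] := zP v.
  apply: inj; [exact: (zP _).1|exact: Mc.1.2|].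
  by rewrite (zP _).2 linearD linearZ /= linearD linearZ /= Tu Tv.
- have [My Ty] := zP y; apply: le_trans (nle _ My) _.
  by rewrite Ty -mulrA ler_wpM2l// invr_ge0 ltW.
exists Z => h Mh; rewrite ZE; apply: inj => //; first exact: (zP _).1.
rewrite (zP _).2; apply: (projector_id Nc.1 (conj QN QO)).
by exists h.
Qed.

End Projectors.

(** * Limits of operators *)

Section Limits.
Context {R : realType}.

Definition increases_to (y : nat -> R) (s : R) :=
  (forall n, y n <= s) /\ forall e, 0 < e -> exists n, s - y n <= e.

Lemma ler_of_gap (y : nat -> R) (s a b C : R) : increases_to y s ->
  (forall n, a <= b + C * (s - y n)) -> a <= b.
Proof.
move=> [ys yl] ab; apply: (@ler_of_eps _ _ _ `|C|) => e /yl[n yn].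
apply: le_trans (ab n) _; rewrite lerD2l (@le_trans _ _ (`|C| * (s - y n)))//.
  by rewrite ler_wpM2r ?subr_ge0 ?ler_norm.
by rewrite ler_wpM2l.
Qed.

Lemma eq_of_gap (V : normedModType R[i]) (y : nat -> R) (s C : R) (u v : V) :
  increases_to y s -> (forall n, nrm (u - v) <= C * (s - y n)) -> u = v.
Proof.
move=> ys H; apply: nrm_sub_le0; apply: (ler_of_gap ys) => n.
by rewrite add0r.
Qed.

(** The differences of the operators being dominated by those of a numerical
sequence, the limit comes with an explicit rate. *)
Lemma limit_operator (V : completeNormedModType R[i]) (T : nat -> 'B(V))
    (y : nat -> R) (s : R) : increases_to y s ->
  (forall n m h, (n <= m)%N -> nrm (T m h - T n h) <= (y m - y n) * nrm h) ->
  exists L : 'B(V), forall n h, nrm (L h - T n h) <= (s - y n) * nrm h.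
Proof.
move=> ys TT; have [yle ygap] := ys.
have lim_ex h : exists l, forall n, nrm (l - T n h) <= (s - y n) * nrm h.
  pose F (e : R) : set V := [set v | exists n, (s - y n) * nrm h <= e /\ v = T n h].
  have [e e0|e d u v e0 d0 [n [ne ->]] [m [md ->]]|l lF] := @complete_family _ V F.
  - have h0 : 0 < nrm h + 1 by rewrite ltr_wpDl ?nrm_ge0.
    have [n yn] := ygap (e / (nrm h + 1)) (divr_gt0 e0 h0).
    exists (T n h), n; split=> //.
    move: yn; rewrite ler_pdivlMr//; have := yle n; lra.
  - have := nrm_ge0 h.
    have [nm|/ltnW mn] := leqP n m.
      by have := TT _ _ h nm; have := yle m; rewrite nrm_distC; nra.
    by have := TT _ _ h mn; have := yle n; nra.
  exists l => n; apply: (@ler_of_eps _ _ _ 1) => e e0; rewrite mul1r.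
  apply: lF; first by rewrite ltr_wpDl// mulr_ge0 ?nrm_ge0 ?subr_ge0.
  by exists n; split=> //; rewrite lerDl ltW.
have [l lP] := choice lim_ex.
have [M M0 TM] := bounded_op_bound (T 0%N).
have [|h|L LE] := @bounded_op_of _ V l (s - y 0%N + M).
- move=> a u v; pose C := nrm (a *: u + v) + complex.Re `|a| * nrm u + nrm v.
  apply: (eq_of_gap (C := C) ys) => n.
  have -> : l (a *: u + v) - (a *: l u + l v) =
      (l (a *: u + v) - T n (a *: u + v)) -
      (a *: (l u - T n u) + (l v - T n v)).
    have zm (x p q r t : V) : x - (p + r) = x - (q + t) - ((p - q) + (r - t)).
      by rewrite (addrACA p) -opprD opprB subrKA.
    have TE : T n (a *: u + v) = a *: T n u + T n v by rewrite linearD linearZ.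
    by rewrite TE scalerBr; exact: zm.
  apply: le_trans (nrmD _ _) _; rewrite nrmN /C.
  have := nrmD (a *: (l u - T n u)) (l v - T n v); rewrite nrmZ.
  have := lP u n; have := lP v n; have := lP (a *: u + v) n.
  have := Re_norm_ge0 a.
  move: (complex.Re _) => c c0; nra.
- have := nrm_dist (T 0%N h) (l h) 0.
  by rewrite !subr0; have := TM h; have := lP h 0%N; lra.
by exists L => n h; rewrite LE.
Qed.

End Limits.

(** * Absolute values of self-adjoint operators *)

Section SquareRootIteration.
Context {R : realType}.

(** The fixed point [y] of [y |-> (x + y ^+ 2) / 2] satisfies
[(1 - y) ^+ 2 = 1 - x], so iterating this map computes square roots. The
iteration for numbers, started at [0] with [x = 1], dominates the iteration
for operators [X] of norm at most one. *)
Definition root_iter n : R := iter n (fun y => 2^-1 * (1 + y ^+ 2)) 0.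

Lemma root_iterS n : root_iter n.+1 = 2^-1 * (1 + root_iter n ^+ 2).
Proof. by []. Qed.

Lemma root_iter_ge0 n : 0 <= root_iter n.
Proof. by case: n => //= n; rewrite mulr_ge0 ?invr_ge0 ?addr_ge0 ?sqr_ge0. Qed.

Lemma root_iter_le1 n : root_iter n <= 1.
Proof.
elim: n => //= n; rewrite -/(root_iter n).
by have := root_iter_ge0 n; nra.
Qed.

Lemma root_iter_le n m : (n <= m)%N -> root_iter n <= root_iter m.
Proof.
move=> /subnK <-; elim: (m - n)%N => //= k; rewrite -/(root_iter _).
have := sqr_ge0 (1 - root_iter (k + n)); nra.
Qed.

Lemma root_iter_increases : exists s, increases_to root_iter s.
Proof.
have rs : has_sup (range root_iter).
  split; first by exists (root_iter 0), 0%N.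
  by exists 1 => _ [n _ <-]; exact: root_iter_le1.
exists (sup (range root_iter)); split=> [n|e e0].
  by apply: ub_le_sup; [exact: rs.2|exists n].
by have [_ [n _ <-] nE] := sup_adherent e0 rs; exists n; lra.
Qed.

Context {V : normedModType R[i]} (X : 'B(V)).

Definition op_root_iter n : 'B(V) :=
  iter n (fun Y => 2^-1%:C *: (X + Y * Y)) 0.

Lemma op_root_iter0 h : op_root_iter 0 h = 0.
Proof. by []. Qed.

Lemma op_root_iterS n h : op_root_iter n.+1 h =
  2^-1%:C *: (X h + op_root_iter n (op_root_iter n h)).
Proof. by []. Qed.

Context (X1 : forall h, nrm (X h) <= nrm h).

Lemma op_root_iter_le n h : nrm (op_root_iter n h) <= root_iter n * nrm h.
Proof.
elim: n h => [|n IH] h; first by rewrite op_root_iter0 nrm0 mul0r.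
rewrite root_iterS op_root_iterS nrmZR ger0_norm ?invr_ge0//.
have := nrmD (X h) (op_root_iter n (op_root_iter n h)).
have := IH (op_root_iter n h); have := IH h; have := X1 h.
by have := root_iter_ge0 n; have := nrm_ge0 h; nra.
Qed.

(** The two factors of a difference of squares are kept apart as
[B * B - A * A = (B - A) * B + A * (B - A)], so [A] and [B] may fail to
commute; with [B] and [A] consecutive iterates, the bounds for the right-hand
side add up to the corresponding difference of numbers. *)
Lemma op_root_iter_cauchy n m h : (n <= m)%N ->
  nrm (op_root_iter m h - op_root_iter n h) <= (root_iter m - root_iter n) * nrm h.
Proof.
have step k g : nrm (op_root_iter k.+1 g - op_root_iter k g) <=
    (root_iter k.+1 - root_iter k) * nrm g.
  elim: k g => [|k IH] g.
    rewrite op_root_iterS root_iterS op_root_iter0 subr0 addr0 nrmZR.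
    rewrite [root_iter 0]/= expr0n /= addr0 subr0 mulr1 ger0_norm ?invr_ge0//.
    by rewrite ler_wpM2l ?invr_ge0.
  set B := op_root_iter k.+1; set A := op_root_iter k.
  have -> : op_root_iter k.+2 g - B g =
      2^-1%:C *: ((B (B g) - A (B g)) + A (B g - A g)).
    rewrite opB addrA subrK (op_root_iterS k.+1) (op_root_iterS k g) -scalerBr.
    by congr (_ *: _); rewrite -!op_root_iterS opprD addrACA subrr add0r.
  rewrite nrmZR ger0_norm ?invr_ge0//.
  have y0 := root_iter_ge0 k.
  have yy : 0 <= root_iter k.+1 - root_iter k by rewrite subr_ge0 root_iter_le.
  have n1 := le_trans (IH (B g)) (ler_wpM2l yy (op_root_iter_le k.+1 g)).
  have n2 := le_trans (op_root_iter_le k (B g - A g)) (ler_wpM2l y0 (IH g)).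
  have yG : root_iter k.+1 * nrm g = 2^-1 * (1 + root_iter k ^+ 2) * nrm g by [].
  have := le_trans (nrmD _ _) (lerD n1 n2); rewrite (root_iterS k.+1).
  by move: (root_iter k.+1) yG {n1 n2 yy} => y' yG; lra.
move=> /subnK <-; elim: (m - n)%N => [|k IH].
  by rewrite add0n !subrr nrm0 mul0r.
have := step (k + n)%N h; rewrite addSn.
have := nrm_dist (op_root_iter (k + n) h) (op_root_iter (k + n).+1 h)
  (op_root_iter n h).
lra.
Qed.

End SquareRootIteration.

Section AbsoluteValue.
Context {R : realType} {H : hilbertType R[i]}.
Implicit Types (A B S T X Y : 'B(H)).

(** Self-adjointness for the real inner product; for complex-linear operators
this is the usual notion. *)
Definition selfadjoint T := forall u v, re (T u) v = re u (T v).

(** Each identity holds for the iterates up to an error of at most a constant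
times [s - root_iter n], where [s] is the limit of [root_iter], and therefore
holds exactly for the limit [Y]. *)
Lemma op_root_exists X : selfadjoint X -> (forall h, nrm (X h) <= nrm h) ->
  exists Y, [/\ selfadjoint Y, forall h, nrm (Y h) <= nrm h,
    forall h, (2 : R)%:C *: Y h = X h + Y (Y h) &
    forall A, A * X = X * A -> A * Y = Y * A].
Proof.
move=> Xsa X1; have [s ys] := root_iter_increases (R := R).
have [Y YL] := limit_operator ys (op_root_iter_cauchy X1).
exists Y; split.
- have Ysa n : selfadjoint (op_root_iter X n).
    elim: n => [|n IH] u v; first by rewrite !op_root_iter0 /re linear0l linear0r.
    by rewrite !op_root_iterS reZl reZr reDl reDr Xsa !IH.
  move=> u v; apply/eqP; rewrite -subr_eq0 -normr_eq0; apply/eqP/le_anti.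
  rewrite normr_ge0 andbT; apply: (ler_of_gap (C := 2 * (nrm u * nrm v)) ys) => n.
  have -> : re (Y u) v - re u (Y v) =
      re (Y u - op_root_iter X n u) v - re u (Y v - op_root_iter X n v).
    by rewrite reBl reBr Ysa; ring.
  rewrite add0r (le_trans (ler_normB _ _))//.
  have := re_le_abs (Y u - op_root_iter X n u) v.
  have := re_le_abs u (Y v - op_root_iter X n v).
  have := YL n u; have := YL n v; have := nrm_ge0 u; have := nrm_ge0 v; nra.
- move=> h; apply: (ler_of_gap (C := nrm h) ys) => n.
  have := YL n h; have := op_root_iter_le X1 n h.
  have := nrm_dist (op_root_iter X n h) (Y h) 0; rewrite !subr0.
  by have := root_iter_le1 (R := R) n; have := nrm_ge0 h; nra.
- move=> h; apply: (eq_of_gap (C := 3 * nrm h + nrm (Y h)) ys) => n.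
  set Yn := op_root_iter X n.
  have YnE : (2 : R)%:C *: op_root_iter X n.+1 h = X h + Yn (Yn h).
    by rewrite op_root_iterS scalerA -rmorphM mulfV ?pnatr_eq0// rmorph1 scale1r.
  apply: le_trans (nrm_dist ((2 : R)%:C *: op_root_iter X n.+1 h) _ _) _.
  rewrite -scalerBr nrmZR ger0_norm// YnE opprD addrACA subrr add0r.
  have := nrm_dist (Yn (Y h)) (Yn (Yn h)) (Y (Y h)); rewrite -opB.
  have := op_root_iter_le X1 n (Yn h - Y h); have := YL n h; have := YL n.+1 h.
  have := YL n (Y h); rewrite (nrm_distC (Yn h)) (nrm_distC (Y (Y h))) -/Yn.
  have := ler_piMl (nrm_ge0 (Y h - Yn h)) (root_iter_le1 (R := R) n).
  have : 0 <= (root_iter n.+1 - root_iter n) * nrm h.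
    by rewrite mulr_ge0 ?nrm_ge0 ?subr_ge0 ?root_iter_le.
  lra.
- move=> A AX; apply: bounded_op_eqP => h; rewrite !opE.
  have [M M0 AM] := bounded_op_bound A.
  have AY n : A * op_root_iter X n = op_root_iter X n * A.
    elim: n => [|n IH]; first by rewrite mulr0 mul0r.
    apply: bounded_op_eqP => u; rewrite (opME A) (opME _ A) !op_root_iterS.
    rewrite linearZ linearD /=.
    have AE T u' : A * T = T * A -> A (T u') = T (A u').
      by move=> E; rewrite -!opME E.
    by rewrite AE// !(AE _ _ IH).
  apply: (eq_of_gap (C := M * nrm h + nrm (A h)) ys) => n.
  have AYh : A (op_root_iter X n h) = op_root_iter X n (A h) by rewrite -!opME AY.
  have := nrm_dist (A (op_root_iter X n h)) (A (Y h)) (Y (A h)).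
  rewrite {2}AYh -opB (nrm_distC (op_root_iter X n (A h))).
  have := YL n (A h); have := YL n h; have := AM (Y h - op_root_iter X n h).
  nra.
Qed.

(** [B] is the square root [1 - Y] of [A * A = 1 - X], where [Y] is the operator
of the previous lemma for [X = 1 - A * A]. *)
Lemma op_abs_exists A : selfadjoint A -> (forall h, nrm (A h) <= nrm h) ->
  exists B, [/\ selfadjoint B, B * B = A * A, A * B = B * A &
    forall h, 0 <= re (B h) h].
Proof.
move=> Asa A1; pose X : 'B(H) := 1 - A * A.
have Xsa : selfadjoint X.
  by move=> u v; rewrite /X !opE reBl reBr !Asa.
have X1 h : nrm (X h) <= nrm h.
  rewrite -ler_sqr ?nnegrE ?nrm_ge0// /X !opE nrmB_sqr.
  rewrite -Asa re_nrm; have := A1 (A h); have := A1 h.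
  by have := nrm_ge0 (A (A h)); have := nrm_ge0 (A h); nra.
have [Y [Ysa Y1 YE YC]] := op_root_exists Xsa X1.
have AY : A * Y = Y * A by apply: YC; rewrite /X mulrBr mulrBl mulr1 mul1r mulrA.
exists (1 - Y); split.
- by move=> u v; rewrite !opE reBl reBr Ysa.
- apply: bounded_op_eqP => h; rewrite !opE.
  rewrite opB.
  have := YE h; rewrite /X !opE rmorphMn rmorph1 scaler_nat mulr2n => E.
  by rewrite opprB addrACA -opprD E opprD addrACA subrr addr0 opprB addrC subrK.
- by rewrite mulrBr mulrBl mulr1 mul1r AY.
- move=> h; rewrite !opE reBl re_nrm subr_ge0.
  apply: le_trans (re_le _ _) _; rewrite expr2 ler_wpM2r ?nrm_ge0//; exact: Y1.
Qed.

(** A substitute for the spectral projection of [S^* S] to the values above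
[1/4]. With [A] proportional to [S^* S - 1/4] and [B] its absolute value,
[M] is the kernel of [B - A]. On [M] one has [A = B >= 0]; on the orthogonal
complement [A = - B <= 0], because the range of [B + A] lies in [M] and [B + A]
is self-adjoint. The sign of [A] at [h] compares [nrm (S h)] with
[nrm h / 2]. *)
Lemma spectral_split S : exists (M : set H) (P : 'B(H)),
  [/\ closed_subspace M, projector M P,
    forall h, M h -> 2^-1 * nrm h <= nrm (S h) &
    forall h, nrm (S (h - P h)) <= 2^-1 * nrm (h - P h)].
Proof.
have [S' S'E] := adjoint_exists S; pose T : 'B(H) := S' * S.
have TE u v : re (T u) v = re (S u) (S v).
  by rewrite reC /re opME -S'E -/(re _ _) reC.
have Tsa : selfadjoint T by move=> u v; rewrite TE (reC u) TE reC.
have [C C0 TC] := bounded_op_bound T.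
pose N : R := C + 1; have N0 : 0 < N by rewrite ltr_wpDl ?ltW.
pose A : 'B(H) := N^-1%:C *: (T - 4^-1%:C *: (1 : 'B(H))).
have AE h : N%:C *: A h = T h - 4^-1%:C *: h.
  by rewrite /A !opE scalerA -rmorphM mulfV ?gt_eqF// rmorph1 scale1r.
have Asa : selfadjoint A.
  by move=> u v; rewrite /A !opE reZl reZr reBl reBr reZl reZr Tsa.
have A1 h : nrm (A h) <= nrm h.
  rewrite -(ler_pM2l N0) -[in leLHS](gtr0_norm N0) -nrmZR AE.
  apply: le_trans (nrmD _ _) _; rewrite nrmN nrmZR ger0_norm ?invr_ge0//.
  by have := TC h; have := nrm_ge0 h; rewrite /N; lra.
have [B [Bsa BB AB B0]] := op_abs_exists Asa A1.
have SE h : nrm (S h) ^+ 2 = N * re (A h) h + 4^-1 * nrm h ^+ 2.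
  by rewrite -re_nrm -TE -reZl AE reBl reZl re_nrm subrK.
have Kc := closed_kernel (B - A); have [P KP] := projector_exists Kc.
exists [set h | (B - A) h = 0], P; split=> // [h Kh|h].
  have /subr0_eq BA : B h - A h = 0 by exact: Kh.
  rewrite -ler_sqr ?nnegrE ?nrm_ge0 ?mulr_ge0 ?nrm_ge0 ?invr_ge0//.
  by rewrite SE -BA; have := mulr_ge0 (ltW N0) (B0 h); lra.
set k := h - P h.
have BA0 : (B - A) * (B + A) = 0 by rewrite mulrDr !mulrBl BB AB addrA subrK subrr.
have BAk : (B + A) k = 0.
  apply: nrm0_eq0; apply/eqP; rewrite -sqrf_eq0 -re_nrm.
  have -> : re ((B + A) k) ((B + A) k) = re k ((B + A) ((B + A) k)).
    by rewrite opDE reDl Bsa Asa -reDr -opDE.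
  rewrite /re KP.2 ?eqxx//.
  by change (((B - A) * (B + A)) ((B + A) k) = 0); rewrite BA0.
have BAE : B k = - A k by apply/eqP; rewrite -addr_eq0 -opDE BAk.
rewrite -ler_sqr ?nnegrE ?nrm_ge0 ?mulr_ge0 ?nrm_ge0 ?invr_ge0// SE.
by have := mulr_ge0 (ltW N0) (B0 k); rewrite BAE reNl; lra.
Qed.

End AbsoluteValue.

(** * Splitting a closed subspace into two equivalent halves *)

Section Halving.
Context {R : realType} {H : hilbertType R[i]}.
Implicit Types (M : set H) (G : set (H * H)).

(** [G] is the graph of a linear isometry between two orthogonal linear subspaces
of [M]. As for functionals, graphs make Zorn's lemma applicable directly. *)
Definition half_graph M G :=
  [/\ forall a u v u' v', G (u, v) -> G (u', v') -> G (a *: u + u', a *: v + v'),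
      forall u v, G (u, v) -> [/\ M u, M v & nrm u = nrm v] &
      forall u v u' v', G (u, v) -> G (u', v') -> inner u v' = 0].

Definition graph_closure G : set (H * H) := [set p | forall e : R, 0 < e ->
  exists u v, [/\ G (u, v), nrm (p.1 - u) <= e & nrm (p.2 - v) <= e]].

Lemma half_graph_closure M G : closed_subspace M -> half_graph M G ->
  half_graph M (graph_closure G).
Proof.
move=> Mc [Glin GM GO].
have clin a x y x' y' : graph_closure G (x, y) -> graph_closure G (x', y') ->
    graph_closure G (a *: x + x', a *: y + y').
  move=> xy xy' e e0; pose c := complex.Re `|a|.
  have c0 : 0 <= c := Re_norm_ge0 a.
  have c1 : 0 < c + 1 by rewrite ltr_wpDl.
  have d0 : 0 < e / (c + 1) by rewrite divr_gt0.
  have dE : e / (c + 1) * (c + 1) = e by rewrite divfK ?gt_eqF.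
  have [u [v [Guv /= xu yv]]] := xy _ d0.
  have [u' [v' [Guv' /= xu' yv']]] := xy' _ d0.
  have bound p q p' q' : nrm (p - q) <= e / (c + 1) ->
      nrm (p' - q') <= e / (c + 1) ->
      nrm (a *: p + p' - (a *: q + q')) <= e.
    move=> pq pq'; rewrite opprD addrACA -scalerBr.
    apply: le_trans (nrmD _ _) _; rewrite nrmZ -/c -dE mulrDr mulr1 lerD//.
    by rewrite mulrC ler_wpM2r.
  exists (a *: u + u'), (a *: v + v'); split; first exact: Glin.
    exact: bound.
  exact: bound.
have re0 (r C : R) : (forall e, 0 < e -> `|r| <= C * e) -> r = 0.
  move=> rC; apply/eqP; rewrite -normr_eq0; apply/eqP/le_anti.
  by rewrite normr_ge0 andbT; apply: (@ler_of_eps _ _ _ C) => e /rC; rewrite add0r.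
split=> // [x y xy|x y x' y' xy xy'].
  split.
  - by apply: Mc.2 => e /xy[u [v [Guv xu _]]]; exists u => //; have [] := GM _ _ Guv.
  - by apply: Mc.2 => e /xy[u [v [Guv _ yv]]]; exists v => //; have [] := GM _ _ Guv.
  - apply/eqP; rewrite -subr_eq0; apply/eqP/(re0 _ 2) => e /xy[u [v [Guv /= xu yv]]].
    have [_ _ uv] := GM _ _ Guv.
    have := nrm_dist u x 0; have := nrm_dist x u 0; rewrite !subr0 (nrm_distC u x).
    have := nrm_dist v y 0; have := nrm_dist y v 0; rewrite !subr0 (nrm_distC v y).
    by rewrite ler_norml; lra.
(* Orthogonality passes to limits in one argument at a time. *)
have step1 z w u v : graph_closure G (z, w) -> G (u, v) -> re z v = 0.
  move=> zw Guv; apply: (re0 _ (nrm v)) => e /zw[u' [v' [Guv' /= zu _]]].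
  have -> : re z v = re (z - u') v.
    by rewrite reBl [X in _ - X]/re (GO _ _ _ _ Guv' Guv) subr0.
  by apply: le_trans (re_le_abs _ _) _; rewrite mulrC ler_wpM2l ?nrm_ge0.
apply: inner_eq0 => a; apply: (re0 _ (nrm x)) => e e0.
have c00 : graph_closure G (0, 0).
  move=> d d0; have [u [v [Guv _ _]]] := xy _ d0.
  exists 0, 0; split; rewrite ?subrr ?nrm0 ?ltW//.
  by have := Glin (-1) _ _ _ _ Guv Guv; rewrite !scaleN1r !addNr.
have := clin a _ _ _ _ xy' c00; rewrite !addr0 => /(_ _ e0)[u [v [Guv _ /= yv]]].
have -> : re x (a *: y') = re x (a *: y' - v).
  by rewrite reBr (step1 _ _ _ _ xy Guv) subr0.
by apply: le_trans (re_le_abs _ _) _; rewrite ler_wpM2l ?nrm_ge0.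
Qed.

Lemma half_graph_extend M G x y : closed_subspace M -> half_graph M G ->
  M x -> M y -> nrm x = nrm y -> inner x y = 0 ->
  (forall u v, G (u, v) ->
     [/\ inner u x = 0, inner u y = 0, inner v x = 0 & inner v y = 0]) ->
  half_graph M [set p | exists u v a, G (u, v) /\ p = (u + a *: x, v + a *: y)].
Proof.
move=> [Ms _] [Glin GM GO] Mx My xy xy0 Gxy; split.
- move=> a _ _ _ _ [u [v [b [Guv [-> ->]]]]] [u' [v' [b' [Guv' [-> ->]]]]].
  exists (a *: u + u'), (a *: v + v'), (a * b + b'); split; first exact: Glin.
  by congr (_, _); rewrite scalerDr scalerDl scalerA addrACA.
- move=> _ _ [u [v [a [Guv [-> ->]]]]]; have [Mu Mv uv] := GM _ _ Guv.
  have [ux _ _ vy] := Gxy _ _ Guv.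
  split; [by apply: linear_subspaceD => //; exact: linear_subspaceZ..|].
  apply/eqP; rewrite -(@eqrXn2 _ 2) ?nrm_ge0// !nrmD_sqr /re !innerZr ux vy.
  by rewrite !nrmZ xy uv.
- move=> _ ? ? _ [u [v [a [Guv [-> _]]]]] [u' [v' [a' [Guv' [_ ->]]]]].
  have [_ uy _ _] := Gxy _ _ Guv; have [_ _ vx _] := Gxy _ _ Guv'.
  rewrite linearDl linearDr /= linearDr /= !innerZl !innerZr (GO _ _ _ _ Guv Guv').
  by rewrite uy xy0 (inner_eq0C vx) !mulr0 !addr0.
Qed.

Lemma maximal_half_graph M : closed_subspace M -> exists G : set (H * H),
  [/\ G (0, 0), half_graph M G &
      forall G', G `<=` G' -> half_graph M G' -> G' `<=` G].
Proof.
move=> Mc; have [| |G [G0 Gh Gmax]] := @Zorn_above _ (half_graph M) [set (0, 0)].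
- split=> [a _ _ _ _ [-> ->] [-> ->]|_ _ [-> ->]|_ ? ? _ [-> _] [_ ->]].
  + by rewrite !scaler0 !addr0.
  + by split=> //; exact: Mc.1.1.
  + by rewrite linear0l.
- move=> F FP _ Ftot.
  have both p q : (\bigcup_(X in F) X) p -> (\bigcup_(X in F) X) q ->
      exists2 X, F X & X p /\ X q.
    move=> [X FX Xp] [Z FZ Zq]; have [XZ|ZX] := Ftot _ _ FX FZ.
      by exists Z => //; split=> //; exact: XZ.
    by exists X => //; split=> //; exact: ZX.
  split=> [a u v u' v' p q|u v [X FX Xp]|u v u' v' p q].
  + have [X FX [Xp Xq]] := both _ _ p q; exists X => //.
    by have [XL _ _] := FP _ FX; exact: XL.
  + by have [_ XM _] := FP _ FX; exact: XM.
  + have [X FX [Xp Xq]] := both _ _ p q.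
    by have [_ _ XO] := FP _ FX; exact: XO Xp Xq.
by exists G; split=> //; exact: G0.
Qed.

Definition half_dom G : set H := [set u | exists v, G (u, v)].
Definition swap_graph G : set (H * H) := [set p | G (p.2, p.1)].

Lemma half_graph_swap M G : half_graph M G -> half_graph M (swap_graph G).
Proof.
move=> [Glin GM GO]; split=> [a u v u' v'|u v /GM[]|u v u' v' p q] //.
  exact: Glin.
by apply: inner_eq0C; exact: GO q p.
Qed.

(** The isometry carries approximations of a point of the closure of its domain
to a Cauchy family, whose limit extends the closed graph to that point. *)
Lemma half_dom_closed M G : G (0, 0) -> half_graph M G ->
  graph_closure G `<=` G -> closed_subspace (half_dom G).
Proof.
move=> G0 [Glin GM GO] Gc; split.
  split=> [|a u u' [v Guv] [v' Guv']]; first by exists 0.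
  by exists (a *: v + v'); exact: Glin.
move=> x xad.
pose F (e : R) : set H := [set v | exists u, G (u, v) /\ nrm (x - u) <= e].
have [e e0|e d v v' e0 d0 [u [Guv xu]] [u' [Guv' xu']]|y yF] :=
  @complete_family _ H F.
- by have [u [v Guv] xu] := xad _ e0; exists v, u.
- have := Glin (-1) _ _ _ _ Guv' Guv; rewrite !scaleN1r => /GM[_ _].
  rewrite ![- _ + _]addrC => <-.
  by have := nrm_dist x u u'; rewrite (nrm_distC u x); lra.
exists y; apply: Gc => e e0; have [u [v Guv] xu] := xad _ e0.
by exists u, v; split=> //; apply: yF => //; exists u.
Qed.

Lemma half_graph_fun M G u v v' : half_graph M G -> G (u, v) -> G (u, v') -> v = v'.
Proof.
move=> [Glin GM _] Guv Guv'; apply: nrm_sub_le0.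
have := Glin (-1) _ _ _ _ Guv' Guv; rewrite !scaleN1r => /GM[_ _].
by rewrite addNr nrm0 addrC => <-.
Qed.

(** The partial isometry [W] that vanishes on the orthogonal complement of the
domain of [G]. *)
Lemma half_graph_op M G P1 : G (0, 0) -> half_graph M G -> 
  projector (half_dom G) P1 -> exists W : 'B(H), forall h, G (P1 h, W h).
Proof.
move=> G0 Gh [P1M _]; have [Glin GM _] := Gh.
have [w wG] := choice P1M.
have [C C0 PC] := bounded_op_bound P1.
have [a u v|h|W WE] := @bounded_op_of _ H w C.
- by apply: (half_graph_fun Gh (wG _)); rewrite linearD linearZ /=; exact: Glin.
- by have [_ _ <-] := GM _ _ (wG h).
by exists W => h; rewrite WE.
Qed.

(** For a maximal [G], let [W] be the partial isometry from its domain [X] to its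
range [Y] and [W'] the one from [Y] to [X]. Then [W' * W] and [W * W'] are the
projections to [X] and [Y], and [W * W = 0] since [X] and [Y] are orthogonal.
The part of [M] orthogonal to [X] and [Y] is at most one-dimensional: two
orthogonal vectors of the same nonzero norm in it would extend [G]. *)
Lemma halving M P : closed_subspace M -> projector M P ->
  exists (W W' F : 'B(H)) (x : H),
  [/\ W * W = 0, P * W * P = W, P = W' * W + W * W' + F &
      forall h, F h = inner h x *: x].
Proof.
move=> Mc PM; have [G [G0 Gh Gmax]] := maximal_half_graph Mc.
have [Glin GM GO] := Gh.
have Gc : graph_closure G `<=` G.
  apply: Gmax; last exact: half_graph_closure.
  by move=> [u v] Guv e e0; exists u, v; rewrite !subrr nrm0; split=> //; exact: ltW.
have G'c : graph_closure (swap_graph G) `<=` swap_graph G.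
  move=> [u v] uv; apply: Gc => e /uv[u' [v' [? ? ?]]].
  by exists v', u'; split.
have Xc := half_dom_closed G0 Gh Gc.
have Yc := half_dom_closed (G := swap_graph G) G0 (half_graph_swap Gh) G'c.
have [P1 PX] := projector_exists Xc; have [P2 PY] := projector_exists Yc.
have [W WG] := half_graph_op G0 Gh PX.
have [W' W'G] := half_graph_op (G := swap_graph G) G0 (half_graph_swap Gh) PY.
have XY u v : half_dom G u -> half_dom (swap_graph G) v -> inner u v = 0.
  by move=> [u' Gu] [v' Gv]; exact: GO Gu Gv.
have XM u : half_dom G u -> M u by move=> [v /GM[]].
have YM v : half_dom (swap_graph G) v -> M v by move=> [u /GM[]].
have WY h : half_dom (swap_graph G) (W h) by exists (P1 h); exact: WG.
have W'X h : half_dom G (W' h) by exists (P2 h); exact: W'G.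
have Gfun u v v' : G (u, v) -> G (u, v') -> v = v' := half_graph_fun Gh.
have Ginj u u' v : G (u, v) -> G (u', v) -> u = u'.
  exact: (half_graph_fun (half_graph_swap Gh)).
have W'W h : W' (W h) = P1 h.
  by apply: Ginj (WG h); have := W'G (W h); rewrite (projector_id Yc.1 PY).
have WW' h : W (W' h) = P2 h.
  by apply: Gfun (W'G h); have := WG (W' h); rewrite (projector_id Xc.1 PX).
pose F : 'B(H) := P - P1 - P2.
pose L h := [/\ M h, forall u, half_dom G u -> inner h u = 0 &
  forall v, half_dom (swap_graph G) v -> inner h v = 0].
have FL h : L (F h).
  split=> [|u Xu|v Yv].
  - by apply: (linear_subspaceB Mc.1); [apply: (linear_subspaceB Mc.1)|]; 
      [exact: PM.1|apply: XM; exact: PX.1|apply: YM; exact: PY.1].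
  - rewrite !linearBl /= (projector_inner _ PM (XM _ Xu)).
    rewrite (projector_inner _ PX Xu) subrr.
    by rewrite sub0r (inner_eq0C (XY _ _ Xu (PY.1 h))) oppr0.
  - rewrite !linearBl /= (projector_inner _ PM (YM _ Yv)) (projector_inner _ PY Yv).
    by rewrite (XY _ _ (PX.1 h) Yv) subr0 subrr.
have noL x y : L x -> L y -> nrm x = nrm y -> inner x y = 0 -> x = 0.
  move=> [Mx xX xY] [My yX yY] xy xy0; apply: orthogonal_self; apply: (xX x).
  exists y; apply: (Gmax _ _ (half_graph_extend Mc Gh Mx My xy xy0 _)).
  - by move=> [u v] Guv; exists u, v, 0; rewrite !scale0r !addr0.
  - move=> u v Guv; have Xu : half_dom G u by exists v.
    have Yv : half_dom (swap_graph G) v by exists u.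
    by split; apply: inner_eq0C; [exact: xX|exact: yX|exact: xY|exact: yY].
  - by exists 0, 0, 1; rewrite !scale1r !add0r.
have Fx h x : L x -> inner (F h) x = inner h x.
  move=> [Mx xX xY]; rewrite !linearBl /= (projector_inner _ PM Mx).
  by rewrite (inner_eq0C (xX _ (PX.1 h))) (inner_eq0C (xY _ (PY.1 h))) !subr0.
have [x xF] : exists x, forall h, F h = inner h x *: x.
  have [[h0 z0]|F0] := pselect (exists h, F h != 0); last first.
    exists 0 => h; rewrite scaler0.
    by have [//|Fh] := eqVneq (F h) 0; case: F0; exists h.
  have LZ a u : L u -> L (a *: u).
    move=> [Mu uX uY]; split=> [|v Xv|v Yv]; first exact: linear_subspaceZ Mc.1 Mu.
      by rewrite innerZl uX// mulr0.
    by rewrite innerZl uY// mulr0.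
  have nunit (u : H) : u != 0 -> nrm ((nrm u)^-1%:C *: u) = 1.
    move=> u0; rewrite nrmZR ger0_norm ?invr_ge0 ?nrm_ge0// mulVf//.
    by rewrite gt_eqF ?nrm_gt0.
  pose x := (nrm (F h0))^-1%:C *: F h0.
  have Lx : L x by apply: LZ.
  have nx : nrm x = 1 by exact: nunit.
  exists x => h; pose y := F h - inner h x *: x.
  have Ly : L y.
    have [MF FX FY] := FL h; have [MZ ZX ZY] := LZ (inner h x) _ Lx.
    split=> [|v Xv|v Yv]; first exact: linear_subspaceB Mc.1 MF MZ.
      by rewrite linearBl /= FX// ZX// subrr.
    by rewrite linearBl /= FY// ZY// subrr.
  have yx : inner x y = 0.
    apply: inner_eq0C; rewrite linearBl /= Fx// innerZl inner_nrm nx expr1n.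
    by rewrite mulr1 subrr.
  have [/eqP|y0] := eqVneq y 0; first by rewrite subr_eq0 => /eqP.
  have x0 : x = 0.
    apply: (noL _ ((nrm y)^-1%:C *: y)) => //; first exact: LZ.
      by rewrite (nunit y).
    by rewrite innerZr yx mulr0.
  by move: nx; rewrite x0 nrm0 => /esym/eqP; rewrite oner_eq0.
exists W, W', F, x; split=> //.
- apply: bounded_op_eqP => h; rewrite !opE.
  apply: (Gfun 0) G0; have := WG (W h).
  rewrite (projector_eq0 Xc.1 PX)// => u Xu.
  by apply: inner_eq0C; exact: XY.
- apply: bounded_op_eqP => h; rewrite !opE (projector_id Mc.1 PM); last exact: YM.
  apply: Gfun (WG h); have := WG (P h).
  suff -> : P1 (P h) = P1 h by [].
  apply/eqP; rewrite -subr_eq0; apply/eqP.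
  rewrite -opB; apply: (projector_eq0 Xc.1 PX) => u Xu.
  by rewrite linearBl /= (projector_inner _ PM (XM _ Xu)) subrr.
- apply: bounded_op_eqP => h; rewrite /F !opE W'W WW'.
  by rewrite [RHS]addrC -[X in X + _]addrA -opprD subrK.
Qed.

End Halving.

(** * Surjective homomorphisms *)

Section Homomorphisms.
Context {R : realType} {H : hilbertType R[i]} {Y : normedModType R[i]}.

Context (psi : 'B(H) -> 'B(Y)) (psiH : algebra_hom psi).
Context (psi_surj : forall T, exists S, psi S = T).

Lemma homM S T : psi (S * T) = psi S * psi T.
Proof. exact: psiH.2. Qed.

Lemma homD S T : psi (S + T) = psi S + psi T.
Proof. by rewrite -[S]scale1r psiH.1 !scale1r. Qed.

Lemma homB S T : psi (S - T) = psi S - psi T.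
Proof. by rewrite addrC -scaleN1r psiH.1 scaleN1r addrC. Qed.

Lemma hom0 : psi 0 = 0.
Proof. by rewrite -[X in psi X](subrr 0) homB subrr. Qed.

Lemma hom1 : psi 1 = 1.
Proof. by have [S S1] := psi_surj 1; rewrite -[LHS]mulr1 -S1 -homM mul1r. Qed.

(** A nonzero ideal contains all operators of rank one: composing a nonzero
member on both sides with operators of rank one gives any of them. *)
Lemma hom_rank_one (T : 'B(H)) : T != 0 -> psi T = 0 ->
  forall (F : 'B(H)) x y, (forall h, F h = inner h x *: y) -> psi F = 0.
Proof.
move=> T0 psiT F x y FE.
have [x0 Tx0] : exists x0, T x0 != 0.
  apply: contrapT => nT; case/eqP: T0; apply: bounded_op_eqP => h.
  by have [//|Th] := eqVneq (T h) 0; case: nT; exists h.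
have rank_one u v : exists E : 'B(H), forall h, E h = inner h u *: v.
  apply: (@bounded_op_of _ H _ (nrm u * nrm v)) => [a h k|h].
    by rewrite linearDl /= innerZl scalerDl scalerA.
  rewrite nrmZ; apply: le_trans (ler_wpM2r (nrm_ge0 v) (inner_le h u)) _.
  by rewrite [nrm h * _]mulrC mulrAC.
have [V VE] := rank_one x x0; have [U UE] := rank_one (T x0) y.
have zz : inner (T x0) (T x0) != 0 by apply: contra_neq Tx0 => /orthogonal_self.
have -> : F = (inner (T x0) (T x0))^-1 *: U * T * V.
  apply: bounded_op_eqP => h; rewrite !opE FE VE linearZ /= UE innerZl.
  by rewrite scalerA mulrCA mulVf// mulr1.
by rewrite !homM psiT mulr0 mul0r.
Qed.

Lemma surjective_hom_injective : (exists y : Y, y != 0) -> injective psi.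
Proof.
move=> [y0 y00] A B AB; apply/eqP; rewrite -subr_eq0; apply: contraT => T0.
have psiT : psi (A - B) = 0 by rewrite homB AB subrr.
have kill := hom_rank_one T0 psiT.
have [e e0 [ee eTe]] := rank_one_idempotent y00.
have [S Se] := psi_surj e.
have [M [P [Mc PM SM SM']]] := spectral_split S.
have half0 : (0 : R) < 2^-1 by rewrite invr_gt0.
(* If psi P vanished, then psi would map S (1 - P), which has norm at most 1/2,
   to the idempotent e; but 1 - S (1 - P) is left invertible and 1 - e is not. *)
have p0 : psi P != 0.
  apply: contra_neq e0 => p0.
  have Tc : closed_subspace [set: H] by [].
  pose Q : 'B(H) := 1 - S * (1 - P).
  have Qlow h : [set: H] h -> 2^-1 * nrm h <= nrm (Q h).
    move=> _; have : nrm (h - P h) <= nrm h.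
      rewrite -ler_sqr ?nnegrE ?nrm_ge0// -[in leRHS](subrK (P h) h).
      rewrite (nrmD_sqr (h - P h)).
      have -> : re (h - P h) (P h) = 0 by rewrite /re (PM.2 _ _ (PM.1 h)).
      by rewrite mulr0 addr0 lerDl sqr_ge0.
    have := SM' h; have := nrm_dist (S (h - P h)) h 0; rewrite !subr0.
    by rewrite [Q h](_ : _ = h - S (h - P h))//; lra.
  have [Z ZQ] := left_inverse_on Tc half0 Qlow.
  have ZQ1 : Z * Q = 1 by apply: bounded_op_eqP => h; rewrite opME ZQ.
  have ZQ2 : psi Z * (1 - e) = 1.
    by rewrite -[RHS]hom1 -ZQ1 homM /Q homB homM homB p0 subr0 hom1 mulr1 Se.
  by rewrite -[e]mul1r -ZQ2 -mulrA mulrBl mul1r ee subrr mulr0.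
(* S is left invertible on M, so psi P lies in the ideal generated by e and
   inherits a corner of dimension one. *)
have [Z ZS] := left_inverse_on Mc half0 SM.
have pE : psi P = psi Z * e * psi P.
  rewrite -Se -!homM; congr psi; apply: bounded_op_eqP => h.
  by rewrite !opE ZS//; exact: PM.1.
have corner W : exists c, psi P * W * psi P = c *: psi P.
  have [c cE] := eTe (psi P * W * psi Z); exists c.
  have -> : psi P * W * psi P = psi Z * (e * (psi P * W * psi Z) * e) * psi P.
    by rewrite {1 2}pE !mulrA.
  by rewrite cE opZAr opZAl -pE.
have [W [W' [F [x [WW PWP PE FE]]]]] := halving Mc PM.
(* The square-zero element psi W is a multiple of the idempotent psi P. *)
have W0 : psi W = 0.
  have [c cE] := corner (psi W); rewrite -!homM PWP in cE.
  have PP : P * P = P.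
    by apply: bounded_op_eqP => h; rewrite opME (projectorK _ Mc.1 PM).
  have : psi W * psi W = 0 by rewrite -homM WW hom0.
  rewrite cE opZAl opZAr scalerA -homM PP => /eqP.
  by rewrite scaler_eq0 (negPf p0) orbF mulf_eq0 orbb => /eqP ->; rewrite scale0r.
case/eqP: p0; rewrite PE !homD !homM W0 mulr0 mul0r !add0r.
exact: kill FE.
Qed.

End Homomorphisms.

Theorem theorem1p3 (R : realType) (H : hilbertType R[i]) : SHAI H.
Proof.
move=> Y Y0 psi psiH psi_surj; exact: surjective_hom_injective psiH psi_surj Y0.
Qed.
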